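(* Let $\kappa=[2\ell]$ for some $\ell\in\mathbb Z$, let $t=F+\check E+\kappa K^{-1}$, and define for $a\ge0$ $$\dot t^{(2a)}=\frac{1}{[2a]!}\prod_{j=-a+1}^{a}\bigl(t-[2j-1]\bigr),\qquad \dot t^{(2a+1)}=\frac{t}{[2a+1]!}\prod_{j=-a+1}^{a}\bigl(t-[2j-1]\bigr).$$ (1) Let $n\in\mathbb N$. For every integer $\lambda$ sufficiently large compared to $n$, the element $\dot t^{(n)}v^+_{2\lambda+1}$ is an $\imath$-canonical basis element of $L(2\lambda+1)$. (2) The set $\{\dot t^{(n)}\mid n\in\mathbb N\}$ is the $\imath$-canonical basis of $\mathbf U^\imath$ for odd weights, and it is an $\mathcal A$-basis of ${}_{\mathcal A}\mathbf U^\imath_{\rm odd}$.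
   Context: $q$ is an indeterminate, $\mathcal A=\mathbb Z[q,q^{-1}]$, $[n]=\frac{q^n-q^{-n}}{q-q^{-1}}$, $[n]!=[1]\cdots[n]$, $[0]!=1$. $\mathbf U$ is the $\mathbb Q(q)$-algebra generated by $E,F,K^{\pm1}$ with relations $KK^{-1}=K^{-1}K=1$, $EF-FE=\frac{K-K^{-1}}{q-q^{-1}}$, $KE=q^2EK$, $KF=q^{-2}FK$; $\check E=q^{-1}EK^{-1}$, $F^{(n)}=F^n/[n]!$. $\mathbf U^\imath$ is the $\mathbb Q(q)$-subalgebra of $\mathbf U$ generated by $t$, and $\psi_\imath$ is the ring involution of $\mathbf U^\imath$ fixing $t$ and sending $q\mapsto q^{-1}$. For $\mu\in\mathbb N$, $L(\mu)$ is the simple $\mathbf U$-module of highest weight $\mu$ with highest weight vector $v^+_\mu$; it has basis $\{F^{(a)}v^+_\mu\}_{0\le a\le\mu}$ whose $\mathcal A$-span is $L(\mu)_{\mathcal A}$. The $\imath$-bar involution $\psi_\imath$ on $L(\mu)$ is the $q\mapsto q^{-1}$ semilinear map with $\psi_\imath(xv^+_\mu)=\psi_\imath(x)v^+_\mu$ for $x\in\mathbf U^\imath$. For $0\le a\le\mu$ the $\imath$-canonical basis element $b^\mu_a\in L(\mu)$ is the unique element with $\psi_\imath(b^\mu_a)=b^\mu_a$ and $b^\mu_a\in F^{(a)}v^+_\mu+\sum_{0\le r<a}q^{-1}\mathbb Z[q^{-1}]F^{(r)}v^+_\mu$ (these exist by Bao–Wang). ${}_{\mathcal A}\mathbf U^\imath_{\rm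 odd}=\{x\in\mathbf U^\imath: xv\in L(\mu)_{\mathcal A}\ \forall v\in L(\mu)_{\mathcal A},\ \forall \mu\in 2\mathbb N+1\}$. The $\imath$-canonical basis of $\mathbf U^\imath$ for odd weights (Bao–Wang) is the family $\{B_n\}_{n\in\mathbb N}\subset{}_{\mathcal A}\mathbf U^\imath_{\rm odd}$ characterized by: for each $n$, $B_nv^+_{2\lambda+1}=b^{2\lambda+1}_n$ for all $\lambda\gg0$. *)

(* Defs.v *)
From HB Require Import structures.
From mathcomp Require Import all_boot all_order all_algebra.
From mathcomp Require Import fraction generic_quotient.
Set Implicit Arguments. Unset Strict Implicit. Unset Printing Implicit Defensive.
Import Order.TTheory GRing.Theory Num.Theory.
Local Open Scope ring_scope.

Definition Kq : fieldType := {fraction {poly rat}}.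
Definition tof (p : {poly rat}) : Kq := @FracField.tofrac _ p.
Definition qq : Kq := tof 'X.

Definition evrat (p : {poly rat}) (z : Kq) : Kq :=
  (map_poly (fun c : rat => tof c%:P) p).[z].
Definition evint (p : {poly int}) (z : Kq) : Kq :=
  (map_poly (fun c : int => c%:~R : Kq) p).[z].

Definition qbar (x : Kq) : Kq :=
  evrat (frac (repr x)).1 qq^-1 / evrat (frac (repr x)).2 qq^-1.

Definition qint (n : int) : Kq := (qq ^ n - qq ^ (- n)) / (qq - qq^-1).
Definition qfact (n : nat) : Kq := \prod_(1 <= i < n.+1) qint i%:Z.

Definition inA (x : Kq) : Prop :=
  exists (p : {poly int}) (k : nat), x = evint p qq / qq ^+ k.
Definition inQinvZ (x : Kq) : Prop :=
  exists (p : {poly int}) (k : nat), (size p <= k)%N /\ x = evint p qq / qq ^+ k.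

(* The simple module L(mu), in the basis v_a = F^(a) v^+_mu, a = 0..mu,
   as column vectors of length mu+1.  The action of t = F + E' + kappa K^-1
   (E' = q^-1 E K^-1), with kappa = [2 l], computed from
   K v_a = q^(mu-2a) v_a, F v_a = [a+1] v_(a+1), E v_a = [mu-a+1] v_(a-1). *)
Definition kappa (l : int) : Kq := qint (2 * l).

Definition tmat (mu : nat) (l : int) : 'M[Kq]_(mu.+1) :=
  \matrix_(i, j)
    (if (i : nat) == j.+1 then qint (j.+1)%:Z
     else if (i : nat).+1 == j then
       qq ^ (2 * (j : nat)%:Z - 1 - mu%:Z) * qint (mu%:Z - (j : nat)%:Z + 1)
     else if (i : nat) == j then kappa l * qq ^ (2 * (j : nat)%:Z - mu%:Z)
     else 0).

(* Elements of U^i (the subalgebra generated by t) are written x = p(t) with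
   p a polynomial over Q(q); their action on L(mu). *)
Definition act (mu : nat) (l : int) (p : {poly Kq}) (v : 'cV[Kq]_(mu.+1))
  : 'cV[Kq]_(mu.+1) := horner_mx (tmat mu l) p *m v.

Definition vplus (mu : nat) : 'cV[Kq]_(mu.+1) := delta_mx 0 0.

Definition psiU (p : {poly Kq}) : {poly Kq} := map_poly qbar p.

(* v is fixed by the i-bar involution of L(mu): psi_i(x v^+) = psi_i(x) v^+ *)
Definition ifixed (mu : nat) (l : int) (v : 'cV[Kq]_(mu.+1)) : Prop :=
  exists p : {poly Kq}, act l p (vplus mu) = v /\ act l (psiU p) (vplus mu) = v.

Definition is_icb (mu : nat) (l : int) (a : nat) (b : 'cV[Kq]_(mu.+1)) : Prop :=
  (a <= mu)%N /\ ifixed l b /\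
  forall r : 'I_(mu.+1),
    (if (r : nat) == a then b r 0 = 1
     else if (r < a)%N then inQinvZ (b r 0) else b r 0 = 0).

Definition inLA (mu : nat) (v : 'cV[Kq]_(mu.+1)) : Prop := forall i, inA (v i 0).

Definition AUodd (l : int) (p : {poly Kq}) : Prop :=
  forall (lam : nat) (v : 'cV[Kq]_((2 * lam + 1).+1)),
    inLA v -> inLA (act l p v).

Definition is_icanon_basis_odd (l : int) (B : nat -> {poly Kq}) : Prop :=
  forall n, AUodd l (B n) /\
    exists lam0 : nat, forall lam : nat, (lam0 <= lam)%N ->
      is_icb l n (act l (B n) (vplus (2 * lam + 1))).

Definition tprod (a : nat) : {poly Kq} :=
  \prod_(i < 2 * a) ('X - (qint (2 * ((i : nat)%:Z - a%:Z + 1) - 1))%:P).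
Definition tdot (n : nat) : {poly Kq} :=
  if odd n then (qfact n)^-1 *: ('X * tprod n./2)
  else (qfact n)^-1 *: tprod n./2.

(* Main.v *)
Require Import Defs.
From HB Require Import structures.
From mathcomp Require Import all_boot all_order all_algebra.
From mathcomp Require Import fraction generic_quotient ring zify.
Set Implicit Arguments. Unset Strict Implicit. Unset Printing Implicit Defensive.
Import Order.TTheory GRing.Theory Num.Theory.
Local Open Scope ring_scope.

(* For a parity e let d^e_n be the polynomials with d^e_0 = 1 and
     t d^e_n = [n+1] d^e_{n+1} + (if n = e mod 2 then [n] d^e_{n-1});
   for e odd these are the i-divided powers of the theorem.  t generates a coideal
   subalgebra: on M (x) L(1) the element t acts as the 2x2 matrix [[q^-1 t, 1], [1, q t]] over Q(q)[t],
   and d^e_n of this matrix has the entries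
     q^-n d'_n + (if n = e mod 2 then q^(1-n) d'_{n-2})   and   d'_{n-1},     d' = d^{1-e},
   (and the conjugate of the former), with no denominators left.  Embedding L(mu+1) in
   L(mu) (x) L(1), integrality of d^e_n on L(mu) for mu = e mod 2 follows by induction on mu.  The
   case mu = 0, integrality of d^e_n([2l]), follows from the same identity applied to scalars, since
   t = [x] gives the 2x2 matrix the eigenvalues [x+1] and [x-1].

   The embedding also computes the coefficients on the highest weight vector: the one of index r+1
   on L(mu+1) for d^e_n is the one of index r on L(mu) for d'_{n-1}, while the one of index 0
   satisfies y_n(mu+1) = q^-n y_n(mu) + (if n = e mod 2 then q^(1-n) y_{n-2}(mu)), so that its
   degree in q becomes negative for large mu.  Being in Z[q,q^-1], it then lies in
   q^-1 Z[q^-1]. *)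

(** * The field Q(q) and its bar involution *)

Lemma tof0 : tof 0 = 0. Proof. exact: tofrac0. Qed.
Lemma tof1 : tof 1 = 1. Proof. exact: tofrac1. Qed.
Lemma tofB a b : tof (a - b) = tof a - tof b. Proof. exact: tofracB. Qed.
Lemma tofD a b : tof (a + b) = tof a + tof b. Proof. exact: tofracD. Qed.
Lemma tofN a : tof (- a) = - tof a. Proof. exact: tofracN. Qed.
Lemma tofM a b : tof (a * b) = tof a * tof b. Proof. exact: tofracM. Qed.
Lemma tofX a n : tof (a ^+ n) = tof a ^+ n. Proof. exact: tofracXn. Qed.
Lemma tof_eq0 a : (tof a == 0) = (a == 0). Proof. exact: tofrac_eq0. Qed.

Definition tofC : {rmorphism rat -> Kq} := (@FracField.tofrac _ \o polyC).

Lemma evratE p z : evrat p z = (map_poly tofC p).[z].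
Proof. by []. Qed.
Lemma evratD a b z : evrat (a + b) z = evrat a z + evrat b z.
Proof. by rewrite !evratE rmorphD hornerD. Qed.
Lemma evratM a b z : evrat (a * b) z = evrat a z * evrat b z.
Proof. by rewrite !evratE rmorphM hornerM. Qed.
Lemma evrat1 z : evrat 1 z = 1.
Proof. by rewrite !evratE rmorph1 hornerC. Qed.
Lemma evratX z : evrat 'X z = z.
Proof. by rewrite !evratE map_polyX hornerX. Qed.
Lemma evrat0 z : evrat 0 z = 0.
Proof. by rewrite !evratE rmorph0 horner0. Qed.

Lemma evrat_qq p : evrat p qq = tof p.
Proof.
elim/poly_ind: p => [|p c IH]; first by rewrite evrat0 tof0.
rewrite evratD evratM evratX IH.
by rewrite evratE map_polyC hornerC tofD tofM.
Qed.

Lemma qq_neq0 : qq != 0.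
Proof. by rewrite tof_eq0 polyX_eq0. Qed.

Lemma qq_expn_neq1 n : qq ^+ n.+1 != 1.
Proof.
rewrite -tof1 -subr_eq0 -tofX -tofB tof_eq0 subr_eq0.
by apply/eqP => /(congr1 (fun p : {poly rat} => size p)); rewrite size_polyXn size_poly1.
Qed.

Lemma expf_rev (F : fieldType) (x : F) i n : x != 0 -> (i < n)%N ->
  x ^+ n * x^-1 ^+ (n - i.+1) = x * x ^+ i.
Proof.
move=> x0 hi; rewrite -{1}(subnK hi) exprD mulrAC exprVn divff ?mul1r ?exprS //.
exact: expf_neq0.
Qed.

(** Reversing the coefficients exchanges [x] and [x^-1]; the degree is one less than [size p],
    whence the extra factor [x]. *)
Lemma horner_rev (R : nzRingType) (F : fieldType) (f : {rmorphism R -> F})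
    (p : {poly R}) (x : F) : x != 0 ->
  x ^+ size p * (map_poly f p).[x^-1] =
  x * (map_poly f (\poly_(i < size p) p`_(size p - i.+1))).[x].
Proof.
move=> x0.
rewrite [in LHS](horner_coef_wide (n := size p)) ?size_poly //.
rewrite [in RHS](horner_coef_wide (n := size p)) ?size_map_poly ?size_poly //; last first.
  exact: leq_trans (size_poly _ _) (size_poly _ _).
rewrite -(big_mkord xpredT (fun i => (map_poly f p)`_i * x^-1 ^+ i)).
rewrite big_nat_rev big_mkord add0n !mulr_sumr; apply: eq_bigr => i _.
rewrite !coef_map coef_poly ltn_ord mulrCA [RHS]mulrCA; congr (_ * _).
exact: (expf_rev x0 (ltn_ord i)).
Qed.

(** q^-1 is transcendental over the rationals: the reversed polynomial would vanish at q, so all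
    coefficients are 0. *)
Lemma evrat_qqV_eq0 (p : {poly rat}) : (evrat p qq^-1 == 0) = (p == 0).
Proof.
apply/eqP/eqP => [h|->]; last by rewrite evrat0.
have := horner_rev tofC p qq_neq0; rewrite -!evratE evrat_qq h mulr0.
move/esym/eqP; rewrite mulf_eq0 (negbTE qq_neq0) /= tof_eq0.
move=> /eqP rev0; apply/polyP => i; rewrite coef0.
case: (ltnP i (size p)) => hi; last by rewrite nth_default.
have := coef_poly (size p) (fun i => p`_(size p - i.+1)) (size p - i.+1).
rewrite rev0 coef0 ltn_subrL (leq_ltn_trans _ hi) //= subnSK // subKn; last exact: ltnW.
by move=> <-.
Qed.

Lemma frac_reprE (x : Kq) : x = tof (frac (repr x)).1 / tof (frac (repr x)).2.
Proof.
have d0 := denom_ratioP (repr x).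
apply: (canRL (mulfK _)); first by rewrite tof_eq0.
rewrite -{1}[x]reprK /tof; unlock FracField.tofrac.
rewrite -[LHS]FracField.pi_mul; apply/eqmodP => /=.
rewrite FracField.equivfE /FracField.mulf.
by rewrite !numden_Ratio ?(oner_eq0, mulr1, mul1r, d0) //= mulrC.
Qed.

(** Independence of the chosen representative: the cross-multiplied equality of two fractions
    survives evaluation at q^-1. Additivity and multiplicativity of [qbar] follow. *)
Lemma qbar_div a b : b != 0 -> qbar (tof a / tof b) = evrat a qq^-1 / evrat b qq^-1.
Proof.
move=> b0; rewrite /qbar; move: (denom_ratioP (repr (tof a / tof b))).
have := frac_reprE (tof a / tof b); case: (frac _) => n d /= e d0; move: e.
move/eqP; rewrite eqr_div ?tof_eq0 // -!tofM tofrac_eq => /eqP.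
move/(congr1 (evrat^~ qq^-1)) => /=; rewrite !evratM => e.
by apply/eqP; rewrite eqr_div ?evrat_qqV_eq0 // e.
Qed.

Lemma qbar_tof a : qbar (tof a) = evrat a qq^-1.
Proof. by rewrite -[tof a]divr1 -tof1 qbar_div ?oner_eq0 // evrat1 divr1. Qed.

Lemma Kq_div (x : Kq) : exists a b, b != 0 /\ x = tof a / tof b.
Proof.
by exists (frac (repr x)).1, (frac (repr x)).2; split;
  [exact: denom_ratioP | exact: frac_reprE].
Qed.

Lemma qbar_is_zmod_morphism : zmod_morphism qbar.
Proof.
move=> x y; have [a [b [b0 ->]]] := Kq_div x; have [c [d [d0 ->]]] := Kq_div y.
rewrite !qbar_div // -!mulNr -tofN !addf_div ?tof_eq0 ?evrat_qqV_eq0 //.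
rewrite -!tofM -tofD qbar_div ?mulf_neq0 // evratD !evratM.
by congr ((_ + _ * _) / _); rewrite !evratE rmorphN hornerN.
Qed.

Lemma qbar_is_monoid_morphism : monoid_morphism qbar.
Proof.
split=> [|x y]; first by rewrite -tof1 qbar_tof evrat1.
have [a [b [b0 ->]]] := Kq_div x; have [c [d [d0 ->]]] := Kq_div y.
by rewrite !qbar_div // !mulf_div -!tofM qbar_div ?mulf_neq0 // !evratM.
Qed.

HB.instance Definition _ := GRing.isZmodMorphism.Build Kq Kq qbar qbar_is_zmod_morphism.
HB.instance Definition _ := GRing.isMonoidMorphism.Build Kq Kq qbar qbar_is_monoid_morphism.

Lemma qbar_qq : qbar qq = qq^-1.
Proof. by rewrite qbar_tof evratX. Qed.

Lemma qbar_qint n : qbar (qint n) = qint n.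
Proof.
rewrite /qint fmorph_div !rmorphB fmorphV !fmorphXz /= qbar_qq invrK.
by rewrite !exprz_inv opprK -opprB -[qq^-1 - qq]opprB invrN mulrNN.
Qed.

(* Otherwise failing unifications compute in the fraction field. *)
Opaque Kq qq.

(** * Quantum integers *)

Lemma qq_qqV_neq0 : qq - qq^-1 != 0.
Proof.
rewrite subr_eq0; apply: contra (qq_expn_neq1 1) => /eqP h.
by rewrite expr2 {1}h mulVf ?qq_neq0.
Qed.

Lemma qint0 : qint 0 = 0.
Proof. by rewrite /qint oppr0 subrr mul0r. Qed.
Lemma qintN n : qint (- n) = - qint n.
Proof. by rewrite /qint opprK -mulNr opprB. Qed.

(** Over an abstract field, with q^n generalised to a unit u, both recursions become rational
    identities in q and u. *)
Lemma qint_succ_field (F : fieldType) (q : F) (n : int) : q != 0 -> q - q^-1 != 0 ->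
  let qi m := (q ^ m - q ^ (- m)) / (q - q^-1) in
  qi (n + 1) = q * qi n + q ^ (- n) /\ qi (n + 1) = q^-1 * qi n + q ^ n.
Proof.
move=> q0 qq1 qi; rewrite /qi.
have -> : q ^ (- n) = (q ^ n)^-1 by rewrite -invr_expz.
have -> : q ^ (- (n + 1)) = (q ^ n)^-1 * q^-1 by rewrite -invr_expz expfzDr // invfM expr1z.
rewrite expfzDr // expr1z.
have un0 : q ^ n != 0 by rewrite expfz_eq0 (negbTE q0) andbF.
move: (q ^ n) un0 => u u0.
have e : q ^+ 2 - 1 != 0.
  by apply: contraNneq qq1 => h; rewrite -[q - _](mulfK q0) mulrBl mulVf // -expr2 h mul0r.
by split; field; rewrite q0 ?u0 -?expr2 ?e.
Qed.

Lemma qint_succ n : qint (n + 1) = qq * qint n + qq ^ (- n).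
Proof. exact: (proj1 (qint_succ_field n qq_neq0 qq_qqV_neq0)). Qed.

Lemma qint_succV n : qint (n + 1) = qq^-1 * qint n + qq ^ n.
Proof. exact: (proj2 (qint_succ_field n qq_neq0 qq_qqV_neq0)). Qed.

Lemma qint1 : qint 1 = 1.
Proof. by rewrite -[1]add0r qint_succ qint0 mulr0 oppr0 expr0z add0r. Qed.

Lemma expf_diff_neq0 (F : fieldType) (x : F) n : x != 0 -> x ^+ (n + n) != 1 ->
  x ^ n%:Z - x ^ (- n%:Z) != 0.
Proof.
move=> x0; apply: contra; rewrite subr_eq0 -invr_expz => /eqP h.
by rewrite exprD {1}[_ ^+ _]h mulVf // expf_neq0.
Qed.

Lemma qint_neq0 n : qint n.+1%:Z != 0.
Proof.
apply: mulf_neq0; last by apply: invr_neq0; exact: qq_qqV_neq0.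
by apply: expf_diff_neq0; [exact: qq_neq0 | exact: qq_expn_neq1].
Qed.

(** * The rings Z[q^-1] and Z[q,q^-1] *)

Lemma evintE p z : evint p z = (map_poly intr p).[z].
Proof. by []. Qed.
Lemma evintD a b z : evint (a + b) z = evint a z + evint b z.
Proof. by rewrite !evintE rmorphD hornerD. Qed.
Lemma evintM a b z : evint (a * b) z = evint a z * evint b z.
Proof. by rewrite !evintE rmorphM hornerM. Qed.
Lemma evint0 z : evint 0 z = 0.
Proof. by rewrite !evintE rmorph0 horner0. Qed.
Lemma evintC c z : evint c%:P z = c%:~R.
Proof. by rewrite !evintE map_polyC hornerC. Qed.
Lemma evintXn k z : evint 'X^k z = z ^+ k.
Proof. by rewrite !evintE map_polyXn hornerXn. Qed.

(** The ring Z[q^-1]. Membership of x in q^-1 Z[q^-1] is expressed below as [inZinv (qq * x)]. *)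
Definition inZinv (x : Kq) : Prop := exists p : {poly int}, x = evint p qq^-1.

Lemma inZinv0 : inZinv 0.
Proof. by exists 0; rewrite evint0. Qed.
Lemma inZinv_int (c : int) : inZinv c%:~R.
Proof. by exists c%:P; rewrite evintC. Qed.
Lemma inZinv1 : inZinv 1.
Proof. exact: inZinv_int 1. Qed.
Lemma inZinvD x y : inZinv x -> inZinv y -> inZinv (x + y).
Proof. by move=> [a ->] [b ->]; exists (a + b); rewrite evintD. Qed.
Lemma inZinvM x y : inZinv x -> inZinv y -> inZinv (x * y).
Proof. by move=> [a ->] [b ->]; exists (a * b); rewrite evintM. Qed.
Lemma inZinv_qqV k : inZinv (qq^-1 ^+ k).
Proof. by exists 'X^k; rewrite evintXn. Qed.

Lemma inA_int (c : int) : inA c%:~R.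
Proof. by exists c%:P, 0; rewrite evintC expr0 divr1. Qed.
Lemma inA0 : inA 0. Proof. exact: inA_int 0. Qed.
Lemma inA1 : inA 1. Proof. exact: inA_int 1. Qed.
Lemma inAM x y : inA x -> inA y -> inA (x * y).
Proof.
move=> [a [k ->]] [b [m ->]]; exists (a * b), (k + m)%N.
by rewrite evintM exprD mulf_div.
Qed.
Lemma inAD x y : inA x -> inA y -> inA (x + y).
Proof.
move=> [a [k ->]] [b [m ->]]; exists (a * 'X^m + b * 'X^k), (k + m)%N.
by rewrite evintD !evintM !evintXn exprD addf_div ?expf_neq0 ?qq_neq0.
Qed.
Lemma inAN x : inA x -> inA (- x).
Proof. by rewrite -mulN1r; apply: inAM (inA_int (-1)). Qed.
Lemma inA_sum (I : Type) (r : seq I) (P : pred I) (f : I -> Kq) :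
  (forall i, P i -> inA (f i)) -> inA (\sum_(i <- r | P i) f i).
Proof. by move=> h; apply: big_ind => //; [exact: inA0 | exact: inAD]. Qed.
Lemma inA_qqz (n : int) : inA (qq ^ n).
Proof.
case: n => n; first by exists 'X^n, 0; rewrite evintXn expr0 divr1.
by exists 1, n.+1; rewrite evintC div1r NegzE -exprnN.
Qed.

Lemma expf_cancel (F : fieldType) (x : F) i n : x != 0 -> (i <= n)%N ->
  x^-1 ^+ n * x ^+ i = x^-1 ^+ (n - i).
Proof.
move=> x0 hi; rewrite -{1}(subnK hi) exprD -mulrA [x^-1 ^+ i]exprVn.
by rewrite mulVf ?expf_neq0 // mulr1.
Qed.

Lemma inA_inZinv x : inA x -> exists D, inZinv (qq^-1 ^+ D * x).
Proof.
move=> [p [k ->]]; exists (size p); rewrite mulrA -exprVn.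
apply: inZinvM (inZinv_qqV k); rewrite evintE horner_coef mulr_sumr.
apply: big_ind => [|x1 x2|i _]; [exact: inZinv0 | exact: inZinvD |].
rewrite mulrCA coef_map expf_cancel ?qq_neq0 //; last first.
  by rewrite (leq_trans (ltnW (ltn_ord i))) ?size_poly.
by apply: inZinvM (inZinv_qqV _); exact: inZinv_int.
Qed.

(** If q x = p(q^-1) and s is the size of p, reversal gives x = r(q) / q^s with r of size at most
    s. *)
Lemma inZinv_inQinvZ x : inZinv (qq * x) -> inQinvZ x.
Proof.
move=> [p h]; exists (\poly_(i < size p) p`_(size p - i.+1)), (size p).
split; first exact: size_poly.
have := horner_rev intr p qq_neq0; rewrite -!evintE -h mulrCA.
move/(mulfI qq_neq0) => <-; rewrite mulrC mulKf ?expf_neq0 ?qq_neq0 //.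
Qed.

(** Induction step for the 2x2 matrix formula. Here u = q^n, [b] says that n = e mod 2, [D0] to [D4]
    stand for d'_{n-2} to d'_{n+2} at [T], and [X0], [X1], [X2] for d^e_n, d^e_{n+1}, d^e_{n+2} at
    [S]. *)
Lemma intertwine_step (F : fieldType) (q u : F) (m k : nat) (b : bool)
    (T D0 D1 D2 D3 D4 : 'M[F]_m) (S X0 X1 X2 : 'M[F]_k) (I0 I1 : 'M[F]_(m, k)) :
  let qi x := (x - x^-1) / (q - q^-1) in
  q != 0 -> q - q^-1 != 0 -> u != 0 -> qi (q ^+ 2 * u) != 0 ->
  q^-1 *: (T *m I0) + I1 = I0 *m S ->
  I0 + q *: (T *m I1) = I1 *m S ->
  S *m X1 = qi (q ^+ 2 * u) *: X2 + (if b then 0 else qi (q * u)) *: X0 ->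
  (~~ b -> T *m D1 = qi u *: D2) ->
  T *m D2 = qi (q * u) *: D3 + (if b then 0 else qi u) *: D1 ->
  T *m D3 = qi (q ^+ 2 * u) *: D4 + (if b then qi (q * u) else 0) *: D2 ->
  I0 *m X0 = (u^-1 *: D2 + (if b then q / u else 0) *: D0) *m I0 + D1 *m I1 ->
  I1 *m X0 = D1 *m I0 + (u *: D2 + (if b then u / q else 0) *: D0) *m I1 ->
  I0 *m X1 = ((q * u)^-1 *: D3 + (if b then 0 else u^-1) *: D1) *m I0 + D2 *m I1 ->
  I1 *m X1 = D2 *m I0 + ((q * u) *: D3 + (if b then 0 else u) *: D1) *m I1 ->
  I0 *m X2 = ((q ^+ 2 * u)^-1 *: D4 + (if b then (q * u)^-1 else 0) *: D2) *m I0
             + D3 *m I1 /\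
  I1 *m X2 = D3 *m I0
             + ((q ^+ 2 * u) *: D4 + (if b then q * u else 0) *: D2) *m I1.
Proof.
move=> qi q0 qq0 u0 qi2 TS0 TS1 SX TD1 TD2 TD3 H00 H10 H01 H11.
have e0 : q ^+ 2 - 1 != 0.
  by apply: contraNneq qq0 => h; rewrite -[q - _](mulfK q0) mulrBl mulVf // -expr2 h mul0r.
have SXa (A : 'M[F]_(m, k)) : qi (q ^+ 2 * u) *: (A *m X2) =
    A *m S *m X1 - (if b then 0 else qi (q * u)) *: (A *m X0).
  by rewrite -mulmxA SX mulmxDr -!scalemxAr addrK.
have mxD := (mulmxDr, mulmxDl, mulmxA, =^~scalemxAl, =^~scalemxAr).
(* After multiplication by [n+2], the recursion eliminates [X2], the intertwining relations
   eliminate [S], and the recursion for d' eliminates [T]; each entry is then a rational identity in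
   q and u. *)
split; apply: (scalerI qi2); rewrite SXa -?TS0 -?TS1 mulmxDl -!scalemxAl -!mulmxA ?H00 ?H10 H01 H11.
all: case: b TD1 TD2 TD3 {H00 H10 H01 H11 SX TS0 TS1 SXa qi2} => TD1 TD2 TD3;
  rewrite !scale0r ?addr0 in TD2 TD3 *; rewrite !mxD TD2 TD3 ?TD1 // !mxD /qi;
  apply/matrixP => i j; rewrite !mxE; field.
all: by rewrite q0 -expr2 e0 u0.
Qed.

(** * The polynomials d^e_n *)

(* [idvp e n] is [d^e_{n-2}]: the shift makes [d^e_{-2} = d^e_{-1} = 0] available. *)
Fixpoint idvp (e : bool) (n : nat) : {poly Kq} :=
  match n with
  | n1.+1 =>
    match n1 with
    | n2.+1 =>
      if n2 is k.+1 then
        (qint k.+1)^-1 *: ('X * idvp e n1 - (if odd k == e then qint k else 0) *: idvp e n2)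
      else 1
    | 0 => 0
    end
  | 0 => 0
  end.

Lemma idvpE e k : idvp e k.+3 =
  (qint k.+1)^-1 *: ('X * idvp e k.+2 - (if odd k == e then qint k else 0) *: idvp e k.+1).
Proof. by []. Qed.

Arguments idvp : simpl never.

Lemma idvp_rec e n :
  'X * idvp e n.+2 =
  qint n.+1 *: idvp e n.+3 + (if odd n == e then qint n else 0) *: idvp e n.+1.
Proof. by rewrite idvpE scalerA divff ?qint_neq0 // scale1r subrK. Qed.

(** The recursion for t d^e_{n-1}, valid also at n = 0 because d^e_{-1} = d^e_{-2} = 0. *)
Lemma idvp_rec_pred e n :
  'X * idvp e n.+1 =
  qint n *: idvp e n.+2 + (if odd n == e then 0 else qint (n%:Z - 1)) *: idvp e n.
Proof.
case: n => [|n]; first by rewrite mulr0 qint0 scale0r scaler0 addr0.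
rewrite idvp_rec /= -[n.+1]addn1 PoszD addrK.
by case: (odd n); case: e.
Qed.

(** The coefficients of the recursion are quantum integers, hence bar invariant. *)
Lemma qbar_idvp e n : map_poly qbar (idvp e n) = idvp e n.
Proof.
have [m] := ubnP n; elim: m n => // m IH [|[|[|k]]] hk.
- exact: rmorph0.
- exact: rmorph0.
- exact: rmorph1.
have h1 := IH k.+2 hk; have h2 := IH k.+1 (ltnW hk).
have q1 : qbar (if odd k == e then qint k else 0) = if odd k == e then qint k else 0.
  by case: ifP => _; [exact: qbar_qint | exact: rmorph0].
have q2 : qbar (qint k.+1)^-1 = (qint k.+1)^-1.
  by rewrite -[in RHS]qbar_qint; exact: fmorphV.
by rewrite idvpE map_polyZ rmorphB rmorphM /= map_polyZ map_polyX /= q1 q2 h1 h2.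
Qed.

Lemma horner_mxZ m (T : 'M[Kq]_m.+1) c p : horner_mx T (c *: p) = c *: horner_mx T p.
Proof. exact: linearZ. Qed.
Lemma horner_mxXM m (T : 'M[Kq]_m.+1) p : horner_mx T ('X * p) = T *m horner_mx T p.
Proof. by rewrite rmorphM /= horner_mx_X. Qed.

Lemma qint_natE (n : nat) : qint n = (qq ^+ n - (qq ^+ n)^-1) / (qq - qq^-1).
Proof. by rewrite /qint -invr_expz. Qed.

Lemma idvp3 e : idvp e 3 = 'X.
Proof. by rewrite idvpE qint1 invr1 scale1r mulr1 scaler0 subr0. Qed.

Lemma idvp_mx_rec m (T : 'M[Kq]_m.+1) e n : T *m horner_mx T (idvp e n.+2) =
  qint n.+1 *: horner_mx T (idvp e n.+3)
  + (if odd n == e then qint n else 0) *: horner_mx T (idvp e n.+1).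
Proof. by rewrite -horner_mxXM idvp_rec rmorphD /= !horner_mxZ. Qed.

(** [I0] and [I1] are the components of a map into two copies of the module of [T], intertwining [S]
    with the 2x2 matrix. They are kept general, to serve both for scalars and for the embedding of
    L(mu+1). *)
Lemma idvp_intertwine m k (T : 'M[Kq]_m.+1) (S : 'M[Kq]_k.+1)
    (I0 I1 : 'M[Kq]_(m.+1, k.+1)) e n :
  qq^-1 *: (T *m I0) + I1 = I0 *m S ->
  I0 + qq *: (T *m I1) = I1 *m S ->
  let hT i := horner_mx T (idvp (~~ e) i) in
  let X := horner_mx S (idvp e n.+2) in
  I0 *m X = ((qq ^+ n)^-1 *: hT n.+2 + (if odd n == e then qq / qq ^+ n else 0) *: hT n) *m I0
            + hT n.+1 *m I1 /\
  I1 *m X = hT n.+1 *m I0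
            + (qq ^+ n *: hT n.+2 + (if odd n == e then qq ^+ n / qq else 0) *: hT n) *m I1.
Proof.
move=> TS0 TS1 hT.
have hT0 : hT 0 = 0 by exact: rmorph0.
have hT1 : hT 1 = 0 by exact: rmorph0.
have hT2 : hT 2 = 1%:M by exact: rmorph1.
have hT3 : hT 3 = T by rewrite /hT idvp3 horner_mx_X.
have hS2 : horner_mx S (idvp e 2) = 1%:M by exact: rmorph1.
have hS3 : horner_mx S (idvp e 3) = S by rewrite idvp3 horner_mx_X.
pose P n := let X := horner_mx S (idvp e n.+2) in
  I0 *m X = ((qq ^+ n)^-1 *: hT n.+2 + (if odd n == e then qq / qq ^+ n else 0) *: hT n) *m I0
            + hT n.+1 *m I1 /\
  I1 *m X = hT n.+1 *m I0
            + (qq ^+ n *: hT n.+2 + (if odd n == e then qq ^+ n / qq else 0) *: hT n) *m I1.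
(* The recursion has three terms, so two consecutive cases are carried along. *)
suff h : P n /\ P n.+1 by exact: (proj1 h).
elim: n => [|n [[H00 H10] [H01 H11]]].
  rewrite /P hS2 hS3 hT0 hT1 hT2 hT3 expr0 expr1 invr1 !scale1r !scaler0 !addr0.
  by rewrite !mulmx1 !mul1mx !mul0mx !add0r !addr0 -TS0 -TS1 -!scalemxAl.
have q0 := qq_neq0.
have un0 := expf_neq0 n q0.
have q2u : qq ^+ 2 * qq ^+ n = qq ^+ n.+2 by rewrite -exprD.
have q1u : qq * qq ^+ n = qq ^+ n.+1 by rewrite -exprS.
have par : (odd n.+1 == e) = ~~ (odd n == e) by rewrite /=; case: (odd n); case: (e).
have parN : (odd n == ~~ e) = ~~ (odd n == e) by case: (odd n); case: (e).
have parN1 : (odd n.+1 == ~~ e) = (odd n == e) by rewrite /=; case: (odd n); case: (e).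
have par2 : (odd n.+2 == e) = (odd n == e) by rewrite /= negbK.
have cq j : qq / qq ^+ j.+1 = (qq ^+ j)^-1 by rewrite exprS invfM mulVKf.
have cq' j : qq ^+ j.+1 / qq = qq ^+ j by rewrite exprS mulrAC divff // mul1r.
split; first by split.
rewrite {}/P par2.
have := @intertwine_step Kq qq (qq ^+ n) m.+1 k.+1 (odd n == e) T (hT n) (hT n.+1)
  (hT n.+2) (hT n.+3) (hT n.+4) S (horner_mx S (idvp e n.+2)) (horner_mx S (idvp e n.+3))
  (horner_mx S (idvp e n.+4)) I0 I1.
rewrite /= q2u q1u -!qint_natE !cq !cq'.
move: H01 H11; rewrite par !if_neg cq cq' => H01 H11.
move=> step; apply: (step q0 qq_qqV_neq0 un0 (qint_neq0 _) TS0 TS1 _ _ _ _ H00 H10 H01 H11).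
- by rewrite idvp_mx_rec par if_neg.
- move=> b; rewrite /hT -horner_mxXM idvp_rec_pred rmorphD /= !horner_mxZ parN b.
  by rewrite scale0r addr0.
- by rewrite /hT idvp_mx_rec parN if_neg.
- by rewrite /hT idvp_mx_rec parN1.
Qed.

(** * Integrality *)

Definition intmx m n (A : 'M[Kq]_(m, n)) : Prop := forall i j, inA (A i j).

Lemma intmxD m n (A B : 'M[Kq]_(m, n)) : intmx A -> intmx B -> intmx (A + B).
Proof. by move=> hA hB i j; rewrite mxE; exact: inAD. Qed.
Lemma intmxM m n p (A : 'M[Kq]_(m, n)) (B : 'M_(n, p)) :
  intmx A -> intmx B -> intmx (A *m B).
Proof. by move=> hA hB i j; rewrite mxE; apply: inA_sum => k _; exact: inAM. Qed.
Lemma intmxZ m n c (A : 'M[Kq]_(m, n)) : inA c -> intmx A -> intmx (c *: A).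
Proof. by move=> hc hA i j; rewrite mxE; exact: inAM. Qed.
Lemma intmx_scalar n c : inA c -> intmx (c%:M : 'M_n).
Proof. by move=> hc i j; rewrite mxE; case: (i == j); [exact: hc | exact: inA0]. Qed.

Lemma intmx_intertwine m k (T : 'M[Kq]_m.+1) (S : 'M[Kq]_k.+1)
    (I0 I1 : 'M[Kq]_(m.+1, k.+1)) e n :
  qq^-1 *: (T *m I0) + I1 = I0 *m S ->
  I0 + qq *: (T *m I1) = I1 *m S ->
  intmx I0 -> intmx I1 ->
  (forall j, intmx (horner_mx T (idvp (~~ e) j))) ->
  intmx (I0 *m horner_mx S (idvp e n)) /\ intmx (I1 *m horner_mx S (idvp e n)).
Proof.
move=> TS0 TS1 h0 h1 hT.
have qn j : inA (qq ^+ j) by exact: (inA_qqz j).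
have qVn j : inA (qq ^+ j)^-1 by rewrite exprnN; exact: inA_qqz.
have q1 := qn 1%N; have q1V := qVn 1%N; rewrite expr1 in q1 q1V.
have int0 (A : 'M[Kq]_(m.+1, k.+1)) : intmx (A *m 0).
  by move=> i j; rewrite mulmx0 mxE; exact: inA0.
case: n => [|[|n]]; try by rewrite rmorph0; split; exact: int0.
have [-> ->] := idvp_intertwine e n TS0 TS1.
split; (apply: intmxD; apply: intmxM => //; apply: intmxD; apply: intmxZ => //).
- by case: ifP => _; [exact: inAM | exact: inA0].
- by case: ifP => _; [exact: inAM | exact: inA0].
Qed.

(** The hypotheses say that the column (1, s) is an eigenvector of the 2x2 matrix at t = a, with
    eigenvalue b. *)
Lemma intmx_scalar_step (a b s : Kq) e :
  qq^-1 * a + s = b -> 1 + qq * (a * s) = s * b -> inA s ->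
  (forall n, intmx (horner_mx (a%:M : 'M_1) (idvp (~~ e) n))) ->
  forall n, intmx (horner_mx (b%:M : 'M_1) (idvp e n)).
Proof.
move=> h1 h2 hs IH n.
have := @intmx_intertwine 0 0 a%:M b%:M 1%:M s%:M e n.
rewrite !mulmx1 !mul1mx -!scalar_mxM -scalemx1 !scale_scalar_mx.
rewrite -!raddfD /= mulr1 h1 h2 => h.
exact: (proj1 (h erefl erefl (intmx_scalar inA1) (intmx_scalar hs) IH)).
Qed.

Lemma qint_steps x :
  qq^-1 * qint x + qq ^ x = qint (x + 1) /\
  1 + qq * (qint x * qq ^ x) = qq ^ x * qint (x + 1).
Proof.
split; first by rewrite -qint_succV.
have xV : qq ^ x * qq ^ (- x) = 1 by rewrite -expfzDr ?qq_neq0 // subrr expr0z.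
by rewrite qint_succ mulrDr xV addrC [qint x * _]mulrC [LHS]addrC mulrCA addrC.
Qed.

(** At t = 0 the recursion links only d_{k+1} and d_{k-1}; the nonzero value d_0 = 1 could enter
    only at k = 1, where the coefficient vanishes by parity. *)
Lemma idvp_false0 k : horner_mx (0%:M : 'M[Kq]_1) (idvp false k.+3) = 0.
Proof.
have X0 p : horner_mx (0%:M : 'M[Kq]_1) ('X * p) = 0.
  by rewrite horner_mxXM raddf0 mul0mx.
have [m] := ubnP k; elim: m k => // m IH k hk.
rewrite idvpE horner_mxZ rmorphB /= X0 horner_mxZ sub0r.
suff -> : (if odd k == false then qint k else 0) *:
    horner_mx (0%:M : 'M[Kq]_1) (idvp false k.+1) = 0 by rewrite oppr0 scaler0.
case: k hk => [|[|k]] hk; first by rewrite qint0 scale0r.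
  by rewrite scale0r.
by rewrite IH ?scaler0 //; exact: ltnW.
Qed.

(** Induction from [0] = 0 with the eigenvectors (1, q^x) and (1, -q^x). Both signs are kept because
    l may be negative in kappa = [2l]. *)
Lemma intmx_qint (x n : nat) :
  intmx (horner_mx ((qint x)%:M : 'M_1) (idvp (odd x) n)) /\
  intmx (horner_mx ((- qint x)%:M : 'M_1) (idvp (odd x) n)).
Proof.
elim: x n => [|x IH] n; last first.
  have [h1 h2] := qint_steps x.
  have x1 : x.+1%:Z = x%:Z + 1 by rewrite -addn1 PoszD.
  rewrite x1; split; [apply: (intmx_scalar_step h1 h2 (inA_qqz x))
    | apply: (@intmx_scalar_step (- qint x) _ (- qq ^ x) _ _ _ (inAN (inA_qqz x)))].
  - by move=> j; rewrite /= negbK; case: (IH j).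
  - by rewrite mulrN -opprD h1.
  - by rewrite mulrNN h2 mulrNN.
  - by move=> j; rewrite /= negbK; case: (IH j).
rewrite qint0 oppr0 /=; suff h : intmx (horner_mx (0%:M : 'M_1) (idvp false n)) by [].
case: n => [|[|[|n]]].
- by rewrite rmorph0 => i j; rewrite mxE; exact: inA0.
- by rewrite rmorph0 => i j; rewrite mxE; exact: inA0.
- by rewrite rmorph1; exact: (intmx_scalar inA1).
- by rewrite idvp_false0 => i j; rewrite mxE; exact: inA0.
Qed.

Lemma intmx_kappa l n : intmx (horner_mx ((kappa l)%:M : 'M_1) (idvp false n)).
Proof.
have even x : odd (2 * x) = false by rewrite oddM.
rewrite /kappa; case: l => x.
  by have [h _] := intmx_qint (2 * x) n; rewrite even in h; rewrite PoszM in h.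
have [_ h] := intmx_qint (2 * x.+1) n; rewrite even in h.
by rewrite NegzE mulrN qintN -PoszM.
Qed.

(** * The tensor product trick *)

(** Entries with unbounded indices, so that shifting an index needs no bound. *)
Definition tent (mu : nat) (l : int) (i j : nat) : Kq :=
  if i == j.+1 then qint (j.+1)%:Z
  else if i.+1 == j then qq ^ (2 * j%:Z - 1 - mu%:Z) * qint (mu%:Z - j%:Z + 1)
  else if i == j then kappa l * qq ^ (2 * j%:Z - mu%:Z) else 0.

Lemma tmatE mu l i j : tmat mu l i j = tent mu l i j.
Proof. by rewrite mxE. Qed.

(* The embedding [v_a |-> q^-a v_a (x) v_0 + v_{a-1} (x) v_1] of L(mu+1) into L(mu) (x) L(1). *)
Definition iota0 mu : 'M[Kq]_(mu.+1, mu.+2) :=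
  \matrix_(i, j) (if (i : nat) == j then qq^-1 ^+ i else 0).
Definition iota1 mu : 'M[Kq]_(mu.+1, mu.+2) :=
  \matrix_(i, j) (if (i : nat).+1 == j then 1 else 0).

Lemma sum_ord_if (n j : nat) (f : nat -> Kq) :
  \sum_(i < n) (if (i : nat) == j then f i else 0) = if (j < n)%N then f j else 0.
Proof. by rewrite -big_mkcond big_ord1_eq. Qed.

Lemma iota0_mul mu p (A : 'M[Kq]_(mu.+2, p)) i j :
  (iota0 mu *m A) i j = qq^-1 ^+ i * A (widen_ord (leqnSn _) i) j.
Proof.
rewrite mxE (bigD1 (widen_ord (leqnSn _) i)) //= mxE eqxx big1 ?addr0 // => k hk.
by rewrite mxE ifN ?mul0r //; apply: contra hk => /eqP e; apply/eqP/val_inj; rewrite /= -e.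
Qed.

Lemma iota1_mul mu p (A : 'M[Kq]_(mu.+2, p)) i j :
  (iota1 mu *m A) i j = A (lift ord0 i) j.
Proof.
rewrite mxE (bigD1 (lift ord0 i)) //= mxE eqxx mul1r big1 ?addr0 // => k hk.
by rewrite mxE ifN ?mul0r //; apply: contra hk => /eqP e; apply/eqP/val_inj; rewrite /= -e.
Qed.

Lemma mul_iota0 mu l i j : (tmat mu l *m iota0 mu) i j = tent mu l i j * qq^-1 ^+ j.
Proof.
rewrite mxE (eq_bigr (fun k : 'I_mu.+1 =>
  if (k : nat) == j then tent mu l i k * qq^-1 ^+ k else 0)); last first.
  by move=> k _; rewrite tmatE mxE; case: ifP; rewrite ?mulr0.
rewrite (sum_ord_if mu.+1 j (fun k => tent mu l i k * qq^-1 ^+ k)).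
(* Column mu+1 lies outside L(mu); the one entry that could be nonzero there carries the factor
   [0]. *)
case: ltnP => // hj; have {hj} hj : (j : nat) = mu.+1.
  by apply/eqP; rewrite eqn_leq hj -ltnS ltn_ord.
have hi := ltn_ord i.
rewrite hj /tent (ltn_eqF hi) (ltn_eqF (ltnW hi : i < mu.+2)%N).
case: ifP => _; last by rewrite mul0r.
by rewrite intS opprD addrA addrAC subrK subrr qint0 mulr0 mul0r.
Qed.

Lemma mul_iota1 mu l i j :
  (tmat mu l *m iota1 mu) i j = if (j : nat) is k.+1 then tent mu l i k else 0.
Proof.
rewrite mxE (eq_bigr (fun k : 'I_mu.+1 =>
  if (k : nat).+1 == j then tent mu l i k else 0)); last first.
  by move=> k _; rewrite tmatE mxE; case: ifP; rewrite ?mulr0 ?mulr1.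
case: j => -[|k] hk /=; first by rewrite big1.
rewrite (eq_bigr (fun k' : 'I_mu.+1 => if (k' : nat) == k then tent mu l i k' else 0)) //.
by rewrite sum_ord_if -ltnS hk.
Qed.

Lemma tent_sub mu l j : tent mu l j.+1 j = qint j.+1.
Proof. by rewrite /tent eqxx. Qed.
Lemma tent_sup mu l i :
  tent mu l i i.+1 = qq ^ (2 * i.+1%:Z - 1 - mu%:Z) * qint (mu%:Z - i.+1%:Z + 1).
Proof. by rewrite /tent eqxx ifN // neq_ltn ltnW. Qed.
Lemma tent_diag mu l i : tent mu l i i = kappa l * qq ^ (2 * i%:Z - mu%:Z).
Proof. by rewrite /tent eqxx !ifN // neq_ltn ltnSn ?orbT. Qed.
Lemma tent_far mu l i j : i != j.+1 -> i.+1 != j -> i != j -> tent mu l i j = 0.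
Proof. by move=> h1 h2 h3; rewrite /tent !ifN. Qed.

Lemma qqzD x y : qq ^ (x + y) = qq ^ x * qq ^ y.
Proof. by rewrite expfzDr ?qq_neq0. Qed.
Lemma qqz_succ x : qq ^ (x + 1) = qq * qq ^ x.
Proof. by rewrite qqzD mulrC. Qed.
Lemma qqV_exp (i : nat) : qq^-1 ^+ i = qq ^ (- i%:Z).
Proof. by rewrite exprVn -invr_expz. Qed.
Lemma qqzK x : qq ^ (- x) * qq ^ x = 1.
Proof. by rewrite -qqzD addNr. Qed.

(** The superdiagonal entries of the relation below: a = q^i, a' = q^-i, w = q^-m, y = q^m, x = [m],
    with m = mu - i. *)
Lemma mulV_cancel5 (F : fieldType) (q a a' w x y : F) : q != 0 -> a' * a = 1 ->
  w * y = 1 ->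
  q^-1 * (q * (a * w) * x * (q^-1 * a')) + 1 = a' * (a * w * (q^-1 * x + y)).
Proof.
move=> q0 ha hw; have -> : a' * (a * w * (q^-1 * x + y)) = a' * a * (q^-1 * w * x + w * y) by ring.
rewrite hw ha mul1r; congr (_ + 1).
have -> : q^-1 * (q * (a * w) * x * (q^-1 * a')) = a' * a * (q^-1 * q) * (q^-1 * w * x) by ring.
by rewrite ha mulVf // !mul1r.
Qed.

(** First component of the compatibility of the embedding with t, compared on each of the three
    diagonals separately. *)
Lemma iota_intertwine0 mu l :
  qq^-1 *: (tmat mu l *m iota0 mu) + iota1 mu = iota0 mu *m tmat mu.+1 l.
Proof.
apply/matrixP => i j; rewrite iota0_mul tmatE mxE [X in X + _]mxE mul_iota0 mxE /=.
move: (i : nat) (j : nat) => {}i {}j.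
have [->|h1] := eqVneq i j.+1.
  rewrite !tent_sub gtn_eqF; last exact: leqnSn.
  by rewrite addr0 exprS [LHS]mulrCA [LHS]mulrC.
have [<-|h2] := eqVneq i.+1 j.
  rewrite !tent_sup exprS !qqV_exp; set m : int := mu%:Z - i%:Z.
  have -> : mu%:Z - i.+1%:Z + 1 = m by rewrite /m; lia.
  have -> : mu.+1%:Z - i.+1%:Z + 1 = m + 1 by rewrite /m; lia.
  have -> : 2 * i.+1%:Z - 1 - mu%:Z = i%:Z - m + 1 by rewrite /m; lia.
  have -> : 2 * i.+1%:Z - 1 - mu.+1%:Z = i%:Z - m by rewrite /m; lia.
  rewrite qqz_succ qqzD qint_succV; exact: mulV_cancel5 qq_neq0 (qqzK _) (qqzK _).
have [<-|h3] := eqVneq i j.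
  rewrite !tent_diag addr0 -[mu.+1]addn1 PoszD opprD addrA [qq ^ (_ - _ - _)]qqzD exprN1.
  by rewrite [LHS]mulrC [RHS]mulrC -!mulrA [_ * qq^-1]mulrC.
by rewrite !tent_far // mul0r !mulr0 addr0.
Qed.

Lemma iota_intertwine1 mu l :
  iota0 mu + qq *: (tmat mu l *m iota1 mu) = iota1 mu *m tmat mu.+1 l.
Proof.
apply/matrixP => i j; rewrite iota1_mul tmatE mxE [X in X + _]mxE [X in _ + X]mxE mul_iota1 lift0.
move: (i : nat) (j : nat) => {}i {}j; case: j => [|j].
  case: i => [|i]; first by rewrite mulr0 addr0 expr0 tent_sub qint1.
  by rewrite mulr0 addr0 tent_far.
have [->|h1] := eqVneq i j.+1.
  by rewrite !tent_sub -[in RHS]addn1 PoszD qint_succ addrC qqV_exp.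
rewrite add0r.
have [->|h2] := eqVneq i j.
  rewrite !tent_diag mulrCA -qqz_succ; congr (_ * qq ^ _); lia.
have [<-|h3] := eqVneq i.+1 j.
  rewrite !tent_sup mulrA -qqz_succ; congr (qq ^ _ * qint _); lia.
by rewrite !tent_far // mulr0.
Qed.

Lemma intmx_tmat mu l n : intmx (horner_mx (tmat mu l) (idvp (odd mu) n)).
Proof.
elim: mu n => [|mu IH] n.
  have -> : tmat 0 l = (kappa l)%:M.
    apply/matrixP => i j; rewrite tmatE !ord1 tent_diag mxE eqxx.
    by rewrite mulr0 subr0 expr0z mulr1.
  exact: intmx_kappa.
have h0 : intmx (iota0 mu).
  by move=> i j; rewrite mxE qqV_exp; case: ifP => _; [exact: inA_qqz | exact: inA0].
have h1 : intmx (iota1 mu).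
  by move=> i j; rewrite mxE; case: ifP => _; [exact: inA1 | exact: inA0].
have [|X0 X1] := @intmx_intertwine _ _ _ _ _ _ (odd mu.+1) n (iota_intertwine0 mu l)
  (iota_intertwine1 mu l) h0 h1; first by move=> j; rewrite /= negbK; exact: IH.
(* Every row of a matrix X is recovered integrally: row i+1 is row i of [iota1 mu *m X], and row 0
   is row 0 of [iota0 mu *m X]. *)
move=> i j; case: (unliftP ord0 i) => [i'|] ->; first by rewrite -iota1_mul; exact: X1.
have := X0 ord0 j; rewrite iota0_mul expr0 mul1r; congr (inA (_ _ j)).
exact: val_inj.
Qed.

(** * The i-divided powers of the theorem *)

Lemma qfactS n : qfact n.+1 = qfact n * qint n.+1.
Proof. by rewrite /qfact big_nat_recr. Qed.
Lemma qfact_neq0 n : qfact n != 0.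
Proof.
elim: n => [|n IH]; first by rewrite /qfact big_geq //; exact: oner_neq0.
by rewrite qfactS; exact: mulf_neq0 IH (qint_neq0 n).
Qed.

(** The two new factors, j = -a and j = a+1, have the opposite roots -[2a+1] and [2a+1]. *)
Lemma tprodS a : tprod a.+1 = ('X^2 - (qint a.*2.+1 ^+ 2)%:P) * tprod a.
Proof.
rewrite [RHS]mulrC /tprod mulnS big_ord_recl.
rewrite big_ord_recr.
rewrite mulrCA.
apply: congr2; last first.
  have e1 : 2 * (0%N%:Z - a.+1%:Z + 1) - 1 = - a.*2.+1%:Z :> int by lia.
  have e2 : 2 * ((bump 0 (2 * a))%:Z - a.+1%:Z + 1) - 1 = a.*2.+1%:Z :> int by rewrite /bump; lia.
  rewrite /= e1 e2 qintN polyCN opprK mulrC.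
  by rewrite -subr_sqr polyC_exp.
apply: eq_bigr => i _; congr ('X - (qint (2 * _ - 1))%:P).
by rewrite /= /bump; lia.
Qed.

Lemma tdot_even a : tdot a.*2 = (qfact a.*2)^-1 *: tprod a.
Proof. by rewrite /tdot odd_double doubleK. Qed.
Lemma tdot_odd a : tdot a.*2.+1 = (qfact a.*2.+1)^-1 *: ('X * tprod a).
Proof. by rewrite /tdot /= odd_double uphalf_double. Qed.

(** The recursion for d_{2a+2}, with f = [2a]!, x = [2a+1] and y = [2a+2]. *)
Lemma scale_sqr_diff (F : fieldType) (f x y : F) (P : {poly F}) : f != 0 -> x != 0 ->
  (f * x * y)^-1 *: (('X^2 - (x ^+ 2)%:P) * P) =
  y^-1 *: ('X * ((f * x)^-1 *: ('X * P)) - x *: (f^-1 *: P)).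
Proof.
move=> f0 x0; rewrite -scalerAr [x *: _]scalerA mulrA -expr2.
have -> : x * f^-1 = (f * x)^-1 * x ^+ 2 by field; rewrite f0 x0.
by rewrite -[(_ * x ^+ 2) *: P]scalerA -scalerBr scalerA mulrBl mul_polyC [in LHS]invfM mulrC.
Qed.

Lemma tdot_idvp_pair a : tdot a.*2 = idvp true a.*2.+2 /\ tdot a.*2.+1 = idvp true a.*2.+3.
Proof.
elim: a => [|a [IH0 IH1]].
  split; first by rewrite (tdot_even 0) /qfact big_geq // invr1 scale1r /tprod big_ord0.
  by rewrite (tdot_odd 0) idvp3 /qfact big_nat1 qint1 invr1 scale1r /tprod big_ord0 mulr1.
have e0 : tdot a.+1.*2 = idvp true a.+1.*2.+2.
  rewrite doubleS idvpE -IH0 -IH1 /= odd_double /= -doubleS tdot_even tprodS.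
  rewrite tdot_even tdot_odd doubleS !qfactS.
  exact: scale_sqr_diff (qfact_neq0 _) (qint_neq0 _).
(* For e odd the recursion at the even index 2a+2 has no correction term. *)
split; first by [].
rewrite doubleS idvpE -doubleS -e0 tdot_odd tdot_even /= odd_double /=.
by rewrite scale0r subr0 -scalerAr scalerA qfactS invfM mulrC.
Qed.

Lemma tdot_idvp n : tdot n = idvp true n.+2.
Proof.
rewrite -(odd_double_half n); have [h0 h1] := tdot_idvp_pair n./2.
by case: (odd n).
Qed.

(** * Coefficients on the highest weight vector *)

Lemma intertwine_col (R : comNzRingType) m k (A0 A1 : 'M[R]_(m, k)) X (P Q W : 'M_m) c d
    (v : 'cV_k) w :
  A0 *m X = (c *: P + d *: Q) *m A0 + W *m A1 -> A0 *m v = w -> A1 *m v = 0 ->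
  A0 *m (X *m v) = c *: (P *m w) + d *: (Q *m w).
Proof.
move=> h v0 v1; rewrite mulmxA h mulmxDl -!mulmxA v0 v1 mulmx0 addr0.
by rewrite mulmxDl -!scalemxAl.
Qed.

Lemma intertwine_col' (R : comNzRingType) m k (A0 A1 : 'M[R]_(m, k)) X (W Z : 'M_m)
    (v : 'cV_k) w :
  A1 *m X = W *m A0 + Z *m A1 -> A0 *m v = w -> A1 *m v = 0 -> A1 *m (X *m v) = W *m w.
Proof. by move=> h v0 v1; rewrite mulmxA h mulmxDl -!mulmxA v0 v1 mulmx0 addr0. Qed.

Lemma lincomb_entry (R : pzRingType) m k (A B : 'M[R]_(m, k)) c d i j :
  (c *: A + d *: B) i j = c * A i j + d * B i j.
Proof. by rewrite !mxE. Qed.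

Section Coefficients.
Variable l : int.

(** Coordinates of d^e_{n-2} v^+ in the basis F^(a) v^+, with the index shift of [idvp]. *)
Definition hwcol mu e n : 'cV[Kq]_mu.+1 := horner_mx (tmat mu l) (idvp e n) *m vplus mu.

Lemma hwcol1 mu e : hwcol mu e 1 = 0.
Proof. by rewrite /hwcol rmorph0 mul0mx. Qed.
Lemma hwcol2 mu e : hwcol mu e 2 = vplus mu.
Proof. by rewrite /hwcol rmorph1 mul1mx. Qed.

Lemma iota0_vplus mu : iota0 mu *m vplus mu.+1 = vplus mu.
Proof.
apply/matrixP => i j; rewrite iota0_mul !mxE ord1 eqxx !andbT.
case: (unliftP ord0 i) => [i'|] -> /=; last by rewrite expr0 mulr1.
by rewrite mulr0.
Qed.
Lemma iota1_vplus mu : iota1 mu *m vplus mu.+1 = 0.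
Proof. by apply/matrixP => i j; rewrite iota1_mul !mxE. Qed.

(** The embedding sends v^+ to v^+ (x) v_0, so the [iota1] terms on the right drop out. *)
Lemma hwcol_rec mu e n :
  iota0 mu *m hwcol mu.+1 e n.+2 = (qq ^+ n)^-1 *: hwcol mu (~~ e) n.+2
    + (if odd n == e then qq / qq ^+ n else 0) *: hwcol mu (~~ e) n /\
  iota1 mu *m hwcol mu.+1 e n.+2 = hwcol mu (~~ e) n.+1.
Proof.
have [h0 h1] := idvp_intertwine e n (iota_intertwine0 mu l) (iota_intertwine1 mu l).
have [v0 v1] := (iota0_vplus mu, iota1_vplus mu).
by split; [exact: intertwine_col h0 v0 v1 | exact: intertwine_col' h1 v0 v1].
Qed.

Lemma hwcol_lift mu e n i :
  hwcol mu.+1 e n.+2 (lift ord0 i) 0 = hwcol mu (~~ e) n.+1 i 0.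
Proof. by rewrite -(hwcol_rec mu e n).2 iota1_mul. Qed.

Lemma hwcol_ord0 mu e n : hwcol mu.+1 e n.+2 ord0 0 =
  (qq ^+ n)^-1 * hwcol mu (~~ e) n.+2 ord0 0
    + (if odd n == e then qq / qq ^+ n else 0) * hwcol mu (~~ e) n ord0 0.
Proof.
have h : (ord0 : 'I_mu.+2) = widen_ord (leqnSn _) ord0 by exact: val_inj.
apply: (@etrans _ _ ((iota0 mu *m hwcol mu.+1 e n.+2) ord0 0)).
  by rewrite iota0_mul expr0 mul1r -h.
by rewrite (hwcol_rec mu e n).1; exact: lincomb_entry.
Qed.

(** Passing from L(mu+1) to L(mu) lowers r and n together, down to d_0 v^+ = v^+. *)
Lemma hwcol_top mu e n (r : 'I_mu.+1) : (n <= r)%N ->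
  hwcol mu e n.+2 r 0 = if (r : nat) == n then 1 else 0.
Proof.
elim: mu e n r => [|mu IH] e n r; last first.
  case: (unliftP ord0 r) => [i|] ->; last first.
    by case: n => // _; rewrite hwcol2 mxE eqxx.
  case: n => [|n] hn; first by rewrite hwcol2 !mxE.
  by rewrite hwcol_lift IH.
by rewrite ord1; case: n => // _; rewrite hwcol2 mxE eqxx.
Qed.
End Coefficients.

(** * Degrees in q for large highest weight *)

Lemma inA_hwcol l mu n (r : 'I_mu.+1) : inA (hwcol l mu (odd mu) n r 0).
Proof.
rewrite /hwcol mxE; apply: inA_sum => k _; apply: inAM; first exact: intmx_tmat.
by rewrite mxE; case: (_ && _); [exact: inA1 | exact: inA0].
Qed.

Lemma inZinv_of_qq x : inZinv (qq * x) -> inZinv x.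
Proof.
move=> h; have := inZinvM (inZinv_qqV 1) h.
by rewrite expr1 mulKf ?qq_neq0.
Qed.

Lemma mul_shuffle (R : comPzRingType) (q p a b x : R) :
  a * (b * p * (q * x)) = b * (q * (p * a * x)).
Proof. by ring. Qed.

(* The recursion multiplies the degree-carrying part of [y] by [q^-1] or less at each step,
   so whatever the degree of [y M] is, it is eventually negative. *)
Lemma eventually_inZinv k M (y w : nat -> Kq) :
  inA (y M) -> (forall m, (M <= m)%N -> inZinv (qq * w m)) ->
  (forall m, y m.+1 = qq^-1 ^+ k.+1 * y m + w m) ->
  exists M', forall m, (M' <= m)%N -> inZinv (qq * y m).
Proof.
move=> /inA_inZinv [D hD] hw rec.
(* Each step beyond M lowers the degree bound by at least one; truncated subtraction leaves the
   exponent at 0 afterwards. *)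
have claim j : inZinv (qq^-1 ^+ (D.+1 - j) * (qq * y (M + j)%N)).
  elim: j => [|j IH].
    by rewrite subn0 addn0 exprSr -mulrA mulKf ?qq_neq0.
  rewrite addnS rec 2!mulrDr; apply: inZinvD; last first.
    by apply: inZinvM (inZinv_qqV _) _; apply: hw; exact: leq_addr.
  have h : inZinv (qq^-1 ^+ (D - j) * qq^-1 * (qq * y (M + j)%N)).
    case: (leqP j D) => hj; first by rewrite -exprSr -subSn.
    have e1 : (D.+1 - j = 0)%N by apply/eqP; rewrite subn_eq0.
    have e2 : (D - j = 0)%N by apply/eqP; rewrite subn_eq0 ltnW.
    rewrite e1 expr0 mul1r in IH; rewrite e2 expr0 mul1r -[qq^-1]expr1.
    exact: inZinvM (inZinv_qqV 1) IH.
  rewrite subSS exprS; have := inZinvM (inZinv_qqV k) h; congr inZinv.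
  exact: mul_shuffle.
exists (M + D.+1)%N => m hm; have := claim (m - M)%N.
have -> : (D.+1 - (m - M) = 0)%N by lia.
rewrite subnKC ?expr0 ?mul1r; last exact: leq_trans (leq_addr _ _) hm.
by [].
Qed.

(** Strong induction on k for d_{k+1}. The term [w] comes from d_{k-1}, which is 0 for k = 0, 1 on
    the highest weight coordinate for k = 1, and of negative degree by induction otherwise; its
    factor q^-k stays in Z[q^-1] after multiplication by q once k is positive. *)
Lemma hwcol_ord0_negative l k : exists M, forall mu, (M <= mu)%N ->
  inZinv (qq * hwcol l mu (odd mu) k.+3 ord0 0).
Proof.
have [m] := ubnP k; elim: m k => // m IH k hk.
pose c mu := (if odd k.+1 == odd mu.+1 then qq / qq ^+ k.+1 else 0).
pose w mu := c mu * hwcol l mu (odd mu) k.+1 ord0 0.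
have [M hM] : exists M, forall mu, (M <= mu)%N -> inZinv (qq * w mu).
  case: k hk @c @w => [|k] hk c w.
    by exists 0 => mu _; rewrite /w hwcol1 mxE !mulr0; exact: inZinv0.
  have [M hM] : exists M, forall mu, (M <= mu)%N -> inZinv (hwcol l mu (odd mu) k.+2 ord0 0).
    case: k hk {c w} => [|k] hk.
      by exists 0 => mu _; rewrite hwcol2 mxE; exact: inZinv1.
    have [M hM] := IH k (ltnW hk); exists M => mu hmu; exact: inZinv_of_qq (hM _ hmu).
  exists M => mu hmu; rewrite mulrA; apply: inZinvM (hM _ hmu).
  rewrite /c; case: ifP => _; last by rewrite mulr0; exact: inZinv0.
  rewrite 2!exprS 2!invfM !mulVKf ?qq_neq0 // -exprVn; exact: inZinv_qqV.
apply: (@eventually_inZinv k M (fun mu => hwcol l mu (odd mu) k.+3 ord0 0) w _ hM).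
  exact: inA_hwcol.
by move=> mu; rewrite hwcol_ord0 /= negbK exprVn.
Qed.

(** The coefficient of index r of d_n on L(mu) is the one of index 0 of d_{n-r} on L(mu-r). Only
    finitely many n-r occur, so one bound serves them all. *)
Lemma hwcol_negative l n : exists M, forall mu (r : 'I_mu.+1), (M <= mu)%N -> (r < n)%N ->
  inZinv (qq * hwcol l mu (odd mu) n.+2 r 0).
Proof.
have [M hM] : exists M, forall k mu, (k < n)%N -> (M <= mu)%N ->
    inZinv (qq * hwcol l mu (odd mu) k.+3 ord0 0).
  elim: n => [|n [M hM]]; first by exists 0%N.
  have [M' hM'] := hwcol_ord0_negative l n; exists (maxn M M') => k mu.
  rewrite ltnS leq_eqVlt geq_max => /orP[/eqP -> | hk] /andP[h h'].
    exact: hM' _ h'.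
  exact: hM _ _ hk h.
suff claim mu n' (r : 'I_mu.+1) : (n' <= n)%N -> (M + r <= mu)%N -> (r < n')%N ->
    inZinv (qq * hwcol l mu (odd mu) n'.+2 r 0).
  exists (M + n)%N => mu r hmu hr; apply: (claim _ _ _ (leqnn n) _ hr).
  by apply: leq_trans hmu; rewrite leq_add2l ltnW.
elim: mu n' r => [|mu IH] n' r hn; last first.
  case: (unliftP ord0 r) => [i|] -> hmu.
    case: n' hn => // n' hn hr; rewrite hwcol_lift /= negbK.
    by apply: IH => //; [exact: ltnW | rewrite -ltnS -addnS].
  case: n' hn => // n' hn _; apply: hM => //; exact: leq_trans (leq_addr _ _) hmu.
rewrite ord1 => hmu; case: n' hn => // n' hn _; apply: hM => //.
exact: leq_trans (leq_addr _ _) hmu.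
Qed.

(** * The polynomials as a basis *)

Lemma size_idvp e n : size (idvp e n.+2) = n.+1.
Proof.
suff h : size (idvp e n.+2) = n.+1 /\ size (idvp e n.+3) = n.+2 by exact: (proj1 h).
elim: n => [|n [IH0 IH1]]; first by rewrite idvp3 size_poly1 size_polyX.
split; first exact: IH1.
have szX : size ('X * idvp e n.+3) = n.+3.
  by rewrite mulrC size_mulX ?IH1 // -size_poly_gt0 IH1.
rewrite idvpE size_scale; last by apply: invr_neq0; exact: qint_neq0.
rewrite size_polyDl szX // size_polyN; apply: leq_ltn_trans (size_scale_leq _ _) _.
by rewrite IH0.
Qed.

Lemma tdot_lead_neq0 n : (tdot n)`_n != 0.
Proof.
have sz : size (tdot n) = n.+1 by rewrite tdot_idvp size_idvp.
have -> : (tdot n)`_n = lead_coef (tdot n) by rewrite lead_coefE sz.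
by rewrite lead_coef_eq0 -size_poly_gt0 sz.
Qed.

Lemma size_tdot n : size (tdot n) = n.+1.
Proof. by rewrite tdot_idvp size_idvp. Qed.

Lemma size_sub_tdot (p : {poly Kq}) N : (size p <= N.+1)%N ->
  (size (p - (p`_N / (tdot N)`_N) *: tdot N)%R <= N)%N.
Proof.
move=> hp; apply/leq_sizeP => j; rewrite leq_eqVlt => /orP[/eqP <- | hj].
  by rewrite coefB coefZ divfK ?subrr //; exact: tdot_lead_neq0.
have pj : p`_j = 0 by apply: nth_default; exact: leq_trans hp hj.
have tj : (tdot N)`_j = 0 by apply: nth_default; rewrite size_tdot.
by rewrite coefB coefZ pj tj mulr0 subr0.
Qed.

Lemma tdot_span N (p : {poly Kq}) : (size p <= N)%N ->
  exists c : nat -> Kq, p = \sum_(n < N) c n *: tdot n.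
Proof.
elim: N p => [|N IH] p hp.
  by exists (fun=> 0); rewrite big_ord0; apply/eqP; rewrite -size_poly_leq0.
have [c hc] := IH _ (size_sub_tdot hp).
exists (fun n => if (n < N)%N then c n else p`_N / (tdot N)`_N).
rewrite big_ord_recr /= ltnn; under eq_bigr => i _ do rewrite ltn_ord.
by rewrite -hc subrK.
Qed.

(** * Action on the odd lattices and integrality of the coefficients *)

Lemma act_tdotE l mu n : act l (tdot n) (vplus mu) = hwcol l mu true n.+2.
Proof. by rewrite /act tdot_idvp. Qed.

Lemma odd_2lam1 lam : odd (2 * lam + 1) = true.
Proof. by rewrite addn1 /= oddM. Qed.

Lemma actD l mu p q (v : 'cV_mu.+1) : act l (p + q) v = act l p v + act l q v.
Proof. by rewrite /act rmorphD mulmxDl. Qed.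
Lemma actZ l mu c p (v : 'cV_mu.+1) : act l (c *: p) v = c *: act l p v.
Proof. by rewrite /act horner_mxZ scalemxAl. Qed.
Lemma act_sum l mu N (f : nat -> {poly Kq}) (v : 'cV_mu.+1) :
  act l (\sum_(n < N) f n) v = \sum_(n < N) act l (f n) v.
Proof. by rewrite /act rmorph_sum mulmx_suml. Qed.

Lemma AUodd_tdot l n : AUodd l (tdot n).
Proof.
move=> lam v hv i; rewrite /act mxE; apply: inA_sum => k _; apply: inAM (hv k).
have := @intmx_tmat (2 * lam + 1) l n.+2 i k.
by rewrite odd_2lam1 tdot_idvp.
Qed.

Lemma add_scale_entry (R : pzRingType) m k (A B : 'M[R]_(m, k)) d i j :
  (A + d *: B) i j = A i j + d * B i j.
Proof. by rewrite !mxE. Qed.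

Lemma AUodd_sub l p q d : AUodd l p -> AUodd l q -> inA d -> AUodd l (p - d *: q).
Proof.
move=> hp hq hd lam v hv i; rewrite -scaleNr actD actZ add_scale_entry.
by apply: inAD; [exact: hp _ _ hv i | exact: inAM (inAN hd) (hq _ _ hv i)].
Qed.

(** The quotient is the coordinate of index N of p v^+: each d_n with n < N contributes 0 there, and
    d_N contributes 1. *)
Lemma inA_lead l N (p : {poly Kq}) : (size p <= N.+1)%N -> AUodd l p -> inA (p`_N / (tdot N)`_N).
Proof.
set d := _ / _ => hp hU.
have [c hc] := tdot_span (size_sub_tdot hp).
(* The odd weight 2N+1 is large enough for index N to exist. *)
have hN : (N < (2 * N + 1).+1)%N by rewrite ltnS mul2n -addnn -addnA leq_addr.
have hv : inLA (vplus (2 * N + 1)).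
  by move=> i; rewrite mxE; case: (_ && _); [exact: inA1 | exact: inA0].
have ep : p = \sum_(n < N) c n *: tdot n + d *: tdot N by rewrite -hc subrK.
have := hU N _ hv (Ordinal hN); rewrite ep actD actZ add_scale_entry.
rewrite (act_sum l N (fun n => c n *: tdot n)) summxE big1 => [|i _].
  by rewrite add0r act_tdotE hwcol_top //= eqxx mulr1.
by rewrite actZ mxE act_tdotE hwcol_top ?(ltnW (ltn_ord i)) //= gtn_eqF ?mulr0.
Qed.

(** The top coefficient lies in A, so subtracting its term preserves integrality and lowers the
    degree. *)
Lemma tdot_span_A l N (p : {poly Kq}) : (size p <= N)%N -> AUodd l p ->
  exists c : nat -> Kq, (forall n, inA (c n)) /\ p = \sum_(n < N) c n *: tdot n.
Proof.
elim: N p => [|N IH] p hp hU.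
  exists (fun=> 0); split; first by move=> _; exact: inA0.
  by rewrite big_ord0; apply/eqP; rewrite -size_poly_leq0.
have hd := inA_lead hp hU.
have [c [hA hc]] := IH _ (size_sub_tdot hp) (AUodd_sub hU (AUodd_tdot l N) hd).
exists (fun n => if (n < N)%N then c n else p`_N / (tdot N)`_N); split.
  by move=> n; case: ifP => _; [exact: hA | exact: hd].
rewrite big_ord_recr /= ltnn; under eq_bigr => i _ do rewrite ltn_ord.
by rewrite -hc subrK.
Qed.

Lemma tdot_free N (c : nat -> Kq) :
  \sum_(n < N) c n *: tdot n = 0 -> forall n, (n < N)%N -> c n = 0.
Proof.
elim: N => // N IH; rewrite big_ord_recr /= => h.
have cN : c N = 0.
  have := congr1 (fun p : {poly Kq} => p`_N) h.
  rewrite coefD coef0 coefZ coef_sum big1 => [/eqP|i _].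
    by rewrite add0r mulf_eq0 (negbTE (tdot_lead_neq0 N)) orbF => /eqP.
  have ti : (tdot i)`_N = 0 by apply: nth_default; rewrite size_tdot.
  by rewrite coefZ ti mulr0.
move: h; rewrite cN scale0r addr0 => /IH h n.
by rewrite ltnS leq_eqVlt => /orP[/eqP -> | /h].
Qed.

Lemma tdot_icb l n : exists lam0 : nat, forall lam : nat, (lam0 <= lam)%N ->
  is_icb l n (act l (tdot n) (vplus (2 * lam + 1))).
Proof.
(* M secures negative degrees of the lower coefficients, and the summand n secures n <= mu. *)
have [M hM] := hwcol_negative l n; exists (M + n)%N => lam hlam.
have lam_le : (lam <= 2 * lam + 1)%N by rewrite mul2n -addnn -addnA leq_addr.
have hmu := leq_trans hlam lam_le.
split; first exact: leq_trans (leq_addl _ _) hmu.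
split.
  (* The polynomial is itself bar invariant, so it witnesses both equalities. *)
  by exists (tdot n); rewrite /psiU tdot_idvp qbar_idvp; split.
move=> r; rewrite act_tdotE; have [rn | nr] := leqP n r.
  by rewrite hwcol_top //; case: eqP => // _; rewrite ltnNge rn.
rewrite (ltn_eqF nr); apply: inZinv_inQinvZ.
have := hM _ r (leq_trans (leq_addr _ _) hmu) nr.
by rewrite odd_2lam1.
Qed.

Theorem theorem3p9 (l : int) :
  (* (1) *)
  (forall n : nat, exists lam0 : nat, forall lam : nat, (lam0 <= lam)%N ->
     exists a : nat, is_icb l a (act l (tdot n) (vplus (2 * lam + 1)))) /\
  (* (2) the i-canonical basis for odd weights ... *)
  is_icanon_basis_odd l tdot /\
  (* ... and an A-basis of _A U^i_odd *)
  ((forall n, AUodd l (tdot n)) /\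
   (forall p : {poly Kq}, AUodd l p ->
      exists (N : nat) (c : nat -> Kq),
        (forall n, inA (c n)) /\ p = \sum_(n < N) c n *: tdot n) /\
   (forall (N : nat) (c : nat -> Kq), (forall n, inA (c n)) ->
      \sum_(n < N) c n *: tdot n = 0 -> forall n, (n < N)%N -> c n = 0)).
Proof.
split; [|split; [|split; [|split]]].
- by move=> n; have [lam0 h] := tdot_icb l n; exists lam0 => lam /h hl; exists n.
- by move=> n; split; [exact: AUodd_tdot | exact: tdot_icb].
- exact: AUodd_tdot.
- move=> p hp; have [c hc] := tdot_span_A (leqnn (size p)) hp.
  by exists (size p), c.
- by move=> N c _ h; exact: tdot_free h.
Qed.
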